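(* Let $\mathcal{T}$ be a tree, $G\leq\mathrm{Aut}(\mathcal{T})$ and $k\in\mathbb{N}$. Then the $k$-closure $G^{(k)}$ satisfies Property $IP_k$.
   Context: All trees are locally finite simple graphs; $\mathbb{N}=\{1,2,3,\dots\}$. $B(v,k)$ is the subtree formed by the closed ball of radius $k$ about the vertex $v$ in the graph metric. For an edge $(v,w)$, the semi-tree $\mathcal{T}_{(v,w)}$ is the connected component containing $w$ of the graph obtained from $\mathcal{T}$ by deleting the edges $(v,w),(w,v)$ (keeping their endpoints). $\mathrm{Fix}_H(Y)$ is the set of $h\in H$ fixing every vertex of $Y$. The $k$-closure of $G\le\mathrm{Aut}(\mathcal{T})$ is the group $G^{(k)}=\{x\in\mathrm{Aut}(\mathcal{T}) : \forall v\in V(\mathcal{T})\ \exists g\in G \text{ with } g|_{B(v,k)}=x|_{B(v,k)}\}$. A group $H\leq\mathrm{Aut}(\mathcal{T})$ satisfies Property $IP_k$ if for every edge $e=(v,w)$ of $\mathcal{T}$, with $F_{k,e}:=\mathrm{Fix}_H(B(v,k)\cap B(w,k))$, one has $F_{k,e}=\mathrm{Fix}_{F_{k,e}}(\mathcal{T}_{(v,w)})\,\mathrm{Fix}_{F_{k,e}}(\mathcal{T}_{(w,v)})$. *)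

(* Defs.v *)
From HB Require Import structures.
From mathcomp Require Import all_boot.
From mathcomp Require Import boolp classical_sets cardinality.

Set Implicit Arguments.
Unset Strict Implicit.
Unset Printing Implicit Defensive.

Local Open Scope classical_set_scope.
Local Open Scope group_scope.

(* With a symmetric irreflexive [adj], a duplicate-free [adj]-cycle has length
   0, 2 (an edge traversed back and forth) or at least 3; only the last are
   cycles of the graph. *)
Record tree := Tree {
  vertex :> eqType;
  adj : rel vertex;
  adj_sym : symmetric adj;
  adj_irr : irreflexive adj;
  tree_locally_finite : forall v, finite_set [set w | adj v w];
  tree_connected : forall v w, exists2 p, path adj v p & last v p = w;
  tree_acyclic : forall c, ucycle adj c -> (size c < 3)%N
}.

Section Metric.
Variable T : tree.
Implicit Types (v w u : T) (p : seq T) (n k : nat).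

Definition walk n v w := exists p, [/\ path (@adj T) v p, size p = n & last v p = w].

Lemma walk_exists v w : exists n, `[< walk n v w >].
Proof. by have [p pp pl] := tree_connected v w; exists (size p); apply/asboolP; exists p. Qed.

Definition dist v w : nat := ex_minn (walk_exists v w).

Definition cball v k : set T := [set u | (dist v u <= k)%N].

Definition adj_del v w : rel T :=
  [rel x y | [&& adj x y, (x, y) != (v, w) & (x, y) != (w, v)]].

Definition semitree v w : set T :=
  [set u | exists2 p, path (adj_del v w) w p & last w p = u].

End Metric.

Record aut (T : tree) := Aut {
  aut_fun :> T -> T;
  aut_inv : T -> T;
  aut_funK : cancel aut_fun aut_inv;
  aut_invK : cancel aut_inv aut_fun;
  aut_adj : {mono aut_fun : x y / adj x y}
}.

Section AutGroup.
Variable T : tree.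
Implicit Types x y z : aut T.

Lemma aut_eqP x y : x =1 y -> x = y.
Proof.
case: x y => [f f' fK f'K fa] [g g' gK g'K ga] /= fg.
have {}fg : f = g by exact/funext.
subst g; have fg' : f' = g' by apply/funext => v; rewrite -[in LHS](g'K v) fK.
by subst g'; congr Aut; exact: Prop_irrelevance.
Qed.

Definition aut_one : aut T :=
  @Aut T id id (fun=> erefl) (fun=> erefl) (fun _ _ => erefl).

Lemma aut_mul_adj x y : {mono x \o y : u v / adj u v}.
Proof. by move=> u v /=; rewrite !aut_adj. Qed.

Definition aut_mul x y : aut T :=
  Aut (can_comp (aut_funK x) (aut_funK y)) (can_comp (aut_invK y) (aut_invK x))
      (aut_mul_adj x y).

Lemma aut_inv_adj x : {mono aut_inv x : u v / adj u v}.
Proof. by move=> u v; rewrite -(aut_adj x) !aut_invK. Qed.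

Definition aut_invg x : aut T := Aut (aut_invK x) (aut_funK x) (aut_inv_adj x).

Lemma aut_mulA : associative aut_mul.
Proof. by move=> x y z; exact: aut_eqP. Qed.
Lemma aut_mul1 : left_id aut_one aut_mul.
Proof. by move=> x; exact: aut_eqP. Qed.
Lemma aut_mulr1 : right_id aut_one aut_mul.
Proof. by move=> x; exact: aut_eqP. Qed.
Lemma aut_mulV : left_inverse aut_one aut_invg aut_mul.
Proof. by move=> x; apply: aut_eqP => v /=; rewrite aut_funK. Qed.
Lemma aut_mulrV : right_inverse aut_one aut_invg aut_mul.
Proof. by move=> x; apply: aut_eqP => v /=; rewrite aut_invK. Qed.

HB.instance Definition _ := gen_eqMixin (aut T).
HB.instance Definition _ := gen_choiceMixin (aut T).
HB.instance Definition _ :=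
  isGroup.Build (aut T) aut_mulA aut_mul1 aut_mulr1 aut_mulV aut_mulrV.

Lemma autM x y v : (x * y) v = x (y v). Proof. by []. Qed.
Lemma aut1 v : (1 : aut T) v = v. Proof. by []. Qed.
Lemma autK x : cancel x x^-1. Proof. exact: aut_funK. Qed.
Lemma autVK x : cancel x^-1 x. Proof. exact: aut_invK. Qed.

Lemma aut_walk x n v w : walk n v w -> walk n (x v) (x w).
Proof.
move=> [p [pp sp lp]]; exists [seq x i | i <- p]; split.
- by rewrite path_map (eq_path (e' := @adj T)) // => u u'; exact: aut_adj.
- by rewrite size_map.
- by rewrite last_map lp.
Qed.

Lemma aut_dist x v w : dist (x v) (x w) = dist v w.
Proof.
apply: eq_ex_minn => n; apply/asboolP/asboolP; last exact: aut_walk.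
by move=> /(@aut_walk x^-1); rewrite !autK.
Qed.

End AutGroup.

Section Closure.
Variables (T : tree) (k : nat).

Definition kclosure (G : groupClosed (aut T)) : {pred aut T} :=
  fun x => `[< forall v, exists2 g : aut T, g \in G & {in cball v k, g =1 x} >].

Lemma kclosureP (G : groupClosed (aut T)) (x : aut T) :
  x \in kclosure G <->
  forall v, exists2 g : aut T, g \in G & {in cball v k, g =1 x}.
Proof. by split => /asboolP. Qed.

Lemma kclosure_group (G : groupClosed (aut T)) : group_closed (kclosure G).
Proof.
split; first by apply/kclosureP => v; exists 1; rewrite ?gpred1.
move=> x y /kclosureP xG /kclosureP yG; apply/kclosureP => v.
have [g gG gx] := xG (y^-1 v); have [h hG hy] := yG (y^-1 v).
exists (g / h); first by rewrite gpredM ?gpredVr.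
move=> u /set_mem vu.
have yu : y^-1 u \in cball (y^-1 v) k by apply/mem_set; rewrite /cball /mkset aut_dist.
by rewrite !autM -(gx _ yu) -[in LHS](autVK y u) -(hy _ yu) autK.
Qed.

HB.instance Definition _ (G : groupClosed (aut T)) :=
  isMulClosed.Build (aut T) (kclosure G) (group_closedM (kclosure_group G)).
HB.instance Definition _ (G : groupClosed (aut T)) :=
  isMul1Closed.Build (aut T) (kclosure G) (proj1 (kclosure_group G)).
HB.instance Definition _ (G : groupClosed (aut T)) :=
  isInvClosed.Build (aut T) (kclosure G) (group_closedV (kclosure_group G)).

End Closure.

Section PropertyIP.
Variable T : tree.

Definition pointwise_fix (H : set (aut T)) (Y : set T) : set (aut T) :=
  [set h | H h /\ {in Y, h =1 id}].

Definition edge_fix (H : groupClosed (aut T)) k (v w : T) : set (aut T) :=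
  pointwise_fix [set` H] (cball v k `&` cball w k).

Definition propertyIP k (H : groupClosed (aut T)) : Prop :=
  forall v w : T, adj v w ->
  let F := edge_fix H k v w in
  F = [set x * y | x in pointwise_fix F (semitree v w) & y in pointwise_fix F (semitree w v)].

End PropertyIP.

(* Main.v *)
Require Import Defs.
From mathcomp Require Import all_boot.
From mathcomp Require Import boolp classical_sets.

(** An element [h] of [F] fixes both ends of the edge [(v, w)], so it preserves
    the two semi-trees, and gluing the identity on one to [h] on the other gives
    an automorphism [x].  A geodesic between the two semi-trees runs through the
    edge, so the points of a [k]-ball lying on the other side from its centre
    are in [B(v, k) :&: B(w, k)], where [h] is the identity.  Hence on each
    [k]-ball [x] agrees either with the identity or with [h]. *)

Set Implicit Arguments.
Unset Strict Implicit.
Unset Printing Implicit Defensive.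

Local Open Scope classical_set_scope.
Local Open Scope group_scope.

Section Semitree.
Variable T : tree.
Implicit Types (a b u v w z : T) (p q : seq T) (k n : nat).

Lemma dist_le_path v p : path (@adj T) v p -> (dist v (last v p) <= size p)%N.
Proof.
move=> pp; rewrite /dist; case: ex_minnP => m _; apply.
by apply/asboolP; exists p.
Qed.

Lemma dist_path v w :
  exists p, [/\ path (@adj T) v p, size p = dist v w & last v p = w].
Proof. by rewrite /dist; case: ex_minnP => m /asboolP. Qed.

Lemma cball_center v k : cball v k v.
Proof. by rewrite /cball /=; exact: leq_trans (@dist_le_path v [::] isT) _. Qed.

Lemma cball_adj v w k : (0 < k)%N -> adj v w -> cball v k w.
Proof.
move=> k0 vw; rewrite /cball /=.
by apply: leq_trans (@dist_le_path v [:: w] _) k0; rewrite /= vw.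
Qed.

Lemma adj_del_sym v w : symmetric (adj_del v w).
Proof.
move=> a b; rewrite /adj_del /= adj_sym !xpair_eqE; congr (_ && _).
by rewrite andbC ![_ && (a == _)]andbC.
Qed.

Lemma adj_delC v w : adj_del v w =2 adj_del w v.
Proof. by move=> a b; rewrite /adj_del /=; congr (_ && _); rewrite andbC. Qed.

Lemma semitree_root v w : semitree v w w.
Proof. by exists [::]. Qed.

Lemma semitree_step v w a b :
  adj_del v w a b -> semitree v w a -> semitree v w b.
Proof.
move=> ab [p pp pl]; exists (rcons p b); last by rewrite last_rcons.
by rewrite rcons_path pp pl.
Qed.

(** Any edge other than the deleted one keeps a walk in the component, and the direction from [v] to
    [w] is ruled out because [w] lies in it. *)
Lemma semitree_crossing v w a b :
  adj a b -> semitree v w a -> ~ semitree v w b -> a = w /\ b = v.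
Proof.
move=> ab Aa nAb.
have [/eqP[_ bw]|ne1] := boolP ((a, b) == (v, w)).
  by case: nAb; rewrite bw; exact: semitree_root.
have [/eqP[-> ->]//|ne2] := boolP ((a, b) == (w, v)).
by case: nAb; apply: semitree_step Aa; rewrite /adj_del /= ab ne1 ne2.
Qed.

(** Follow a path from [w]: one can leave a semi-tree only across the edge, and this lands on the
    root of the other one. *)
Lemma semitree_cover v w u : semitree v w u \/ semitree w v u.
Proof.
have [p pp <-] := tree_connected w u.
elim/last_ind: p pp => [_|p b IHp]; first by left; exact: semitree_root.
rewrite rcons_path last_rcons => /andP[/IHp IH ab].
have [Ab|nAb] := pselect (semitree v w b); first by left.
have [Bb|nBb] := pselect (semitree w v b); first by right.
case: IH => [/(semitree_crossing ab)/(_ nAb)[_ bv]|].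
  by case: nBb; rewrite bv; exact: semitree_root.
move=> /(semitree_crossing ab)/(_ nBb)[_ bw].
by case: nAb; rewrite bw; exact: semitree_root.
Qed.

(** A common vertex would give a path from [w] to [v] avoiding the edge; made simple and closed up
    by the edge, it contradicts acyclicity. *)
Lemma semitree_disjoint v w u :
  adj v w -> semitree v w u -> semitree w v u -> False.
Proof.
move=> vw [p pp pu] [q qp qu].
have [r rp rv] : exists2 r, path (adj_del v w) w r & last w r = v.
  (* Go to [u] along [p], then back along [q]; [belast] drops the second copy of [u] and keeps
     [v]. *)
  exists (p ++ rev (belast v q)).
    rewrite cat_path pp pu -qu rev_path (eq_path (e' := adj_del w v)) //.
    by move=> a b; rewrite adj_del_sym; exact: adj_delC.
  rewrite last_cat pu; case: (q) qu => [<-|b q' _] //.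
  by rewrite /= rev_cons last_rcons.
case/shortenP: rp rv => {}r rp ru _ rv.
have radj : path (@adj T) w r.
  by apply: sub_path rp => a b /= /and3P[].
have : (size (w :: r) < 3)%N.
  apply: (@tree_acyclic T); rewrite /ucycle /= rcons_path radj rv vw /=.
  exact: ru.
(* At most one step is left: no step forces [w = v], and a single step is the deleted edge. *)
case: r rp rv {ru radj} => [_ /= wv|b [|//] /=].
  by move: vw; rewrite wv adj_irr.
by move=> /andP[/and3P[_ _ nwv] _] bv; move: nwv; rewrite bv eqxx.
Qed.

Lemma semitreeNP v w u : adj v w -> ~ semitree v w u <-> semitree w v u.
Proof.
move=> vw; split=> [nA|Bu Au]; last exact: semitree_disjoint vw Au Bu.
by have [] := semitree_cover v w u.
Qed.

(** The witness is the rest of the path after its first crossing. The strict inequality pays for the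
    extra edge when [cball_crossing] restarts from [w]. *)
Lemma path_crossing v w a p : path (@adj T) a p ->
    semitree v w a -> ~ semitree v w (last a p) ->
  exists q, [/\ path (@adj T) v q, last v q = last a p & (size q < size p)%N].
Proof.
elim: p a => [|b p IHp] a //= /andP[ab bp] Aa nAl.
have [Ab|nAb] := pselect (semitree v w b).
  by have [q [qp ql qs]] := IHp b bp Ab nAl; exists q; split=> //; exact: ltnW.
by have [_ bv] := semitree_crossing ab Aa nAb; exists p; rewrite -bv.
Qed.

Lemma cball_crossing v w a z k : adj v w ->
    semitree v w a -> semitree w v z -> cball a k z ->
  (cball v k `&` cball w k) z.
Proof.
move=> vw Aa /(semitreeNP _ vw) nAz; rewrite /cball /= => azk.
have [p [pp ps pl]] := dist_path a z.
have [|q [qp ql qs]] := path_crossing pp Aa; first by rewrite pl.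
rewrite pl in ql; rewrite ps in qs; rewrite -ql; split.
  exact: leq_trans (dist_le_path qp) (leq_trans (ltnW qs) azk).
apply: leq_trans (leq_trans qs azk).
by apply: (@dist_le_path w (v :: q)); rewrite /= adj_sym vw.
Qed.

(** Fixing both ends, [h] preserves the deleted edge, hence maps paths of the cut graph to paths of
    the cut graph. *)
Lemma aut_semitree (h : aut T) v w u : h v = v -> h w = w ->
  semitree v w u -> semitree v w (h u).
Proof.
move=> hv hw [p pp <-]; exists (map h p); last by rewrite -[in LHS]hw last_map.
rewrite -[X in path _ X]hw path_map (eq_path (e' := adj_del v w)) // => a b /=.
have hE c d : (h c == d) = (c == h^-1 d).
  by rewrite -[in RHS](inj_eq (can_inj (autK h))) autVK.
have hVv : h^-1 v = v by rewrite -[in LHS]hv autK.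
have hVw : h^-1 w = w by rewrite -[in LHS]hw autK.
by rewrite /adj_del /= aut_adj !xpair_eqE !hE hVv hVw.
Qed.

Definition glue_fun v w (h : aut T) u := if `[< semitree v w u >] then u else h u.

Lemma glue_in v w (h : aut T) u : semitree v w u -> glue_fun v w h u = u.
Proof. by rewrite /glue_fun; case: asboolP. Qed.

Lemma glue_out v w (h : aut T) u :
  ~ semitree v w u -> glue_fun v w h u = h u.
Proof. by rewrite /glue_fun; case: asboolP. Qed.

(** Since [h] preserves the side of [v], both maps take the same branch of the definition. *)
Lemma glue_funK v w (h : aut T) : adj v w -> h v = v -> h w = w ->
  cancel (glue_fun v w h) (glue_fun v w h^-1).
Proof.
move=> vw hv hw u; have [Au|nAu] := pselect (semitree v w u).
  by rewrite !glue_in.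
rewrite (glue_out _ nAu) glue_out ?autK //.
by apply/(semitreeNP _ vw)/aut_semitree => //; apply/(semitreeNP _ vw).
Qed.

Lemma glue_exists v w (h : aut T) : adj v w -> h v = v -> h w = w ->
  exists x : aut T, (forall u, semitree v w u -> x u = u) /\
                    (forall u, semitree w v u -> x u = h u).
Proof.
move=> vw hv hw.
have hVv : h^-1 v = v by rewrite -[in LHS]hv autK.
have hVw : h^-1 w = w by rewrite -[in LHS]hw autK.
have gK := glue_funK vw hv hw.
have gVK : cancel (glue_fun v w h^-1) (glue_fun v w h).
  by have := glue_funK vw hVv hVw; rewrite invgK.
(* Only the edge itself joins the two sides, and [h] fixes its ends. *)
have cross a b : semitree v w a -> ~ semitree v w b -> adj a (h b) = adj a b.
  move=> Aa nAb; have nAhb : ~ semitree v w (h b).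
    by apply/(semitreeNP _ vw)/aut_semitree => //; apply/(semitreeNP _ vw).
  apply/idP/idP => ab.
    have [aw hbv] := semitree_crossing ab Aa nAhb.
    by rewrite -(autK h b) hbv hVv aw adj_sym.
  by have [-> ->] := semitree_crossing ab Aa nAb; rewrite hv adj_sym.
have gadj : {mono glue_fun v w h : a b / adj a b}.
  move=> a b.
  have [Aa|nAa] := pselect (semitree v w a);
    have [Ab|nAb] := pselect (semitree v w b).
  - by rewrite !glue_in.
  - by rewrite glue_in // glue_out // cross.
  - by rewrite glue_out // glue_in // adj_sym cross // adj_sym.
  - by rewrite !glue_out // aut_adj.
exists (Aut gK gVK gadj); split=> u uT /=; first exact: glue_in.
by apply: glue_out; apply/(semitreeNP _ vw).
Qed.

End Semitree.

Section Closure.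
Variables (T : tree) (G : groupClosed (aut T)) (k : nat).
Implicit Types (v w : T) (h : aut T).

Lemma edge_fixC (H : groupClosed (aut T)) v w :
  edge_fix H k v w = edge_fix H k w v.
Proof. by rewrite /edge_fix setIC. Qed.

(** For positive [k] both ends lie in both balls; for [k = 0] the intersection would be empty. *)
Lemma edge_fix_ends (H : groupClosed (aut T)) v w h :
  (0 < k)%N -> adj v w -> edge_fix H k v w h -> h v = v /\ h w = w.
Proof.
move=> k0 vw [_ hfix]; split; apply: hfix; apply/mem_set; split.
- exact: cball_center.
- by apply: cball_adj => //; rewrite adj_sym.
- exact: cball_adj.
- exact: cball_center.
Qed.

Lemma edge_fix_glue v w h : (0 < k)%N -> adj v w ->
    edge_fix (kclosure k G) k v w h ->
  exists2 x, pointwise_fix (edge_fix (kclosure k G) k v w) (semitree v w) x &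
             forall u, semitree w v u -> x u = h u.
Proof.
move=> k0 vw hF; have [hv hw] := edge_fix_ends k0 vw hF.
have [x [x1 xh]] := glue_exists vw hv hw.
case: hF => hG hfix; exists x => //.
have wv : adj w v by rewrite adj_sym.
split; last by move=> u /set_mem/x1.
split; last first.
  move=> u uB; have [/x1//|/xh->] := semitree_cover v w u.
  exact: hfix.
(* The side of the centre [u] decides the local witness: [1] on the side of [w], and on the side of
   [v] the element of [G] that agrees with [h] on the ball. *)
apply/kclosureP => u; have [Au|Bu] := semitree_cover v w u.
  exists 1; first exact: gpred1.
  move=> z /set_mem uz; have [/x1->//|Bz] := semitree_cover v w z.
  by rewrite xh // hfix //; apply/mem_set/(cball_crossing vw Au Bz).
have [g gG gh] := (kclosureP k G h).1 hG u; exists g => // z uz.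
rewrite gh //; have [Az|/xh->//] := semitree_cover v w z.
rewrite x1 // hfix //; apply/mem_set; rewrite setIC.
exact: (cball_crossing wv Bu Az (set_mem uz)).
Qed.

End Closure.

Theorem proposition5p2 (T : tree) (G : groupClosed (aut T)) (k : nat) :
  (0 < k)%N -> propertyIP k (kclosure k G).
Proof.
move=> k0 v w vw F; apply/seteqP; split=> [h hF|h].
  have wv : adj w v by rewrite adj_sym.
  have [x xF xh] := edge_fix_glue k0 vw hF.
  have [y yF yh] : exists2 y, pointwise_fix F (semitree w v) y &
                     forall u, semitree v w u -> y u = h u.
    by rewrite /F edge_fixC; apply: edge_fix_glue; rewrite // edge_fixC.
  have [hv hw] := edge_fix_ends k0 vw hF.
  exists x => //; exists y => //; apply: aut_eqP => u; rewrite autM.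
  (* On the side of [w], [y] acts as [h] and stays there, where [x] is trivial; on the side of [v],
     [y] is trivial and [x] acts as [h]. *)
  have [Au|Bu] := semitree_cover v w u.
    by rewrite yh // xF.2 //; apply/mem_set/aut_semitree.
  by rewrite yF.2 ?xh //; apply/mem_set.
move=> [x [[xG xfix] _] [y [[yG yfix] _] <-]]; split; first exact: gpredM.
by move=> u uB; rewrite autM yfix // xfix.
Qed.
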